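(* Let $K_{ff}$ be invertible, $C=K_{ff}^{-1}$, and let $A$ and $B$ be disjoint sets of free degrees of freedom. Write $X=C[A,A]$ and $Y=C[B,B]$ and assume both are invertible. Then $$D_{B\leftarrow A}=C[B,A]\,X^{-1},$$ with no symmetry hypothesis. If $K_{ff}=K_{ff}^{T}$ then, writing $D_1=D_{B\leftarrow A}$ and $D_2=D_{A\leftarrow B}$, $$D_1X=(D_2Y)^{T}=C[B,A],$$ and if in addition $K_{ff}\succ0$ then the spectrum of the product satisfies $$\operatorname{spec}(D_2D_1)\subset[0,1).$$
   Context: $K_{ff}$ is a real square matrix (the stiffness operator of a network restricted to its free degrees of freedom), whose rows and columns are indexed by the free degrees of freedom. For disjoint index sets $A,B$, $D_{B\leftarrow A}\in\mathbb{R}^{|B|\times|A|}$ is the matrix of read-out displacements on $B$ produced by a prescribed displacement pattern on $A$, all remaining free degrees of freedom (those of $B$ included) equilibrating: for $u_A\in\mathbb{R}^{A}$ prescribed, $u$ is the solution of $(K_{ff}u)_i=0$ for every free $i\notin A$ with $u|_A=u_A$, and $D_{B\leftarrow A}u_A=u|_B$. (Invertibility of $X$ is equivalent to this problem being uniquely solvable.) $D_{A\leftarrow B}$ is defined with the roles exchanged. *)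

(* Defs.v *)
From mathcomp Require Import all_boot all_order all_algebra.
From mathcomp Require Import reals.
From mathcomp Require Import complex.
Set Implicit Arguments.
Unset Strict Implicit.
Unset Printing Implicit Defensive.
Import Order.TTheory GRing.Theory Num.Theory.
Local Open Scope ring_scope.

(* The free degrees of freedom are the elements of 'I_n.  For
   S : {set 'I_n}, vectors and matrices indexed by S are indexed by 'I_#|S|
   through the increasing enumeration enum_val of S. *)

Definition block (R : realType) (n : nat) (M : 'M[R]_n) (S T : {set 'I_n})
  : 'M[R]_(#|S|, #|T|) :=
  mxsub (fun i : 'I_#|S| => enum_val i) (fun j : 'I_#|T| => enum_val j) M.

Definition restrict (R : realType) (n : nat) (u : 'cV[R]_n) (S : {set 'I_n})
  : 'cV[R]_#|S| :=
  rowsub (fun i : 'I_#|S| => enum_val i) u.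

Definition equilibrium (R : realType) (n : nat) (K : 'M[R]_n) (A : {set 'I_n})
    (uA : 'cV[R]_#|A|) (u : 'cV[R]_n) : Prop :=
  (forall i : 'I_n, i \notin A -> (K *m u) i 0 = 0) /\ restrict u A = uA.
Arguments equilibrium {R n} K A uA u.

(* is_readout K A B D says that D is D_{B <- A} (from A to B).  Unique
   solvability for every prescribed pattern is part of the definition, so at
   most one D qualifies, and none does when the problem is ill-posed. *)
Definition is_readout (R : realType) (n : nat) (K : 'M[R]_n)
    (A B : {set 'I_n}) (D : 'M[R]_(#|B|, #|A|)) : Prop :=
  forall uA : 'cV[R]_#|A|,
    (exists! u : 'cV[R]_n, equilibrium K A uA u) /\
    (forall u : 'cV[R]_n, equilibrium K A uA u -> D *m uA = restrict u B).
Arguments is_readout {R n} K A B D.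

Definition posdef (R : realType) (n : nat) (K : 'M[R]_n) : Prop :=
  forall x : 'cV[R]_n, x != 0 -> 0 < (x^T *m K *m x) 0 0.

(* The spectrum is taken over the complex numbers R[i]. *)
Definition spec (R : realType) (m : nat) (M : 'M[R]_m) : pred R[i] :=
  eigenvalue (map_mx (real_complex R) M).

(* Main.v *)
(* A state in equilibrium off A is u = C P_A^T f for a load f carried by A, where
   P_A restricts to A; prescribing u on A forces f = X^-1 u_A.  In the symmetric
   case D2 D1 = Z X^-1 with Z = C[A,B] Y^-1 C[B,A], so its spectrum is that of
   the pencil (Z, X); if K is positive definite then so are X and the Schur
   complement X - Z, while Z is positive semidefinite. *)
Require Import Defs.
From mathcomp Require Import all_boot all_order all_algebra.
From mathcomp Require Import reals.
From mathcomp Require Import complex.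
From mathcomp Require Import ring lra.
Set Implicit Arguments.
Unset Strict Implicit.
Unset Printing Implicit Defensive.
Import Order.TTheory GRing.Theory Num.Theory.
Local Open Scope ring_scope.

Section Selection.

Variables (R : realType) (n : nat).
Implicit Types (A B S T : {set 'I_n}) (M K : 'M[R]_n).

(** Restriction to [S] as a matrix, the $P_S$ of the idea above: blocks of [M] become products $P_S
    M P_T^T$, and the transpose is extension by zero. *)
Definition selmx S : 'M[R]_(#|S|, n) :=
  rowsub (fun i : 'I_#|S| => enum_val i) 1%:M.

Lemma restrictE (u : 'cV[R]_n) S : Defs.restrict u S = selmx S *m u.
Proof. by rewrite /selmx mul_rowsub_mx mul1mx. Qed.

Lemma blockE M S T : block M S T = selmx S *m M *m (selmx T)^T.
Proof.
rewrite /selmx mul_rowsub_mx mul1mx trmx_mxsub trmx1.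
by rewrite mulmx_colsub mulmx1; apply/matrixP => i j; rewrite !mxE.
Qed.

Lemma selmx_mul_tr S : selmx S *m (selmx S)^T = 1%:M.
Proof.
have := blockE 1%:M S S; rewrite mulmx1 => <-.
by apply/matrixP => i j; rewrite !mxE (inj_eq enum_val_inj).
Qed.

Lemma selmx_mul_tr_disjoint S T :
  [disjoint S & T] -> selmx S *m (selmx T)^T = 0.
Proof.
move=> dST; have := blockE 1%:M S T; rewrite mulmx1 => <-.
apply/matrixP => i j; rewrite !mxE; case: eqP => // eij.
have := disjointFr dST (enum_valP i).
by rewrite eij enum_valP.
Qed.

(** Turns the equations off [A] in [equilibrium] into the existence of a load [f] carried by [A]. *)
Lemma selmx_tr_mulP S (x : 'cV[R]_n) :
  (forall i, i \notin S -> x i 0 = 0) <-> exists f, x = (selmx S)^T *m f.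
Proof.
split=> [x0|[f ->] i iS]; last first.
  rewrite mxE big1 // => j _; rewrite !mxE; case: eqP => [eij|]; last first.
    by rewrite mul0r.
  by rewrite -eij enum_valP in iS.
exists (selmx S *m x); apply/matrixP => i k; rewrite ord1 -restrictE {k}.
rewrite [RHS]mxE; have [iS|iS] := boolP (i \in S); last first.
  rewrite x0 // big1 // => j _; rewrite !mxE; case: eqP => [eij|]; last first.
    by rewrite mul0r.
  by rewrite -eij enum_valP in iS.
(* For [i] in [S], only the term at the rank of [i] in the enumeration of [S] survives. *)
rewrite (bigD1 (enum_rank_in iS i)) //= !mxE enum_rankK_in // eqxx mul1r.
rewrite big1 ?addr0 // => j jNi; rewrite !mxE.
case: eqP => [eij|]; last by rewrite mul0r.
by rewrite -[j](enum_valK_in iS) eij eqxx in jNi.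
Qed.

Lemma equilibriumE K A (uA : 'cV[R]_#|A|) (u : 'cV[R]_n) :
  K \in unitmx -> block (invmx K) A A \in unitmx ->
  equilibrium K A uA u <->
  u = invmx K *m (selmx A)^T *m invmx (block (invmx K) A A) *m uA.
Proof.
move=> hK; set X := block _ A A => hX.
have XE : X = selmx A *m invmx K *m (selmx A)^T by apply: blockE.
split=> [[/selmx_tr_mulP[f Kf] uAE]|->]; last first.
  split; last by rewrite restrictE !mulmxA -XE mulmxV // mul1mx.
  apply/selmx_tr_mulP; exists (invmx X *m uA).
  by rewrite !mulmxA mulmxV // mul1mx.
(* Restricting this expression to [A] gives [uA = X *m f], which eliminates the unknown load [f]. *)
have uE : u = invmx K *m (selmx A)^T *m f by rewrite -mulmxA -Kf mulKmx.
by rewrite -uAE restrictE {2}uE !mulmxA -(mulmxA _ (selmx A)) -!mulmxA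
  (mulmxA (selmx A)) (mulmxA _ _ f) -XE mulKmx // mulmxA.
Qed.

Lemma is_readoutE K A B (D : 'M[R]_(#|B|, #|A|)) :
  K \in unitmx -> block (invmx K) A A \in unitmx ->
  is_readout K A B D <->
  D = block (invmx K) B A *m invmx (block (invmx K) A A).
Proof.
move=> hK hX; split=> [hD|-> uA].
  suff mulD (uA : 'cV[R]_#|A|) : D *m uA
      = block (invmx K) B A *m invmx (block (invmx K) A A) *m uA.
    (* Unit patterns recover [D] column by column. *)
    apply/matrixP => i j; have /matrixP/(_ i 0) := mulD (delta_mx j 0).
    by rewrite -!colE [LHS]mxE [RHS]mxE.
  have [_ DuA] := hD uA.
  rewrite (DuA _ (proj2 (equilibriumE _ _ hK hX) erefl)).
  by rewrite restrictE (blockE _ B A) !mulmxA.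
have eqE u := equilibriumE uA u hK hX.
split=> [|u /eqE ->]; last by rewrite restrictE (blockE _ B A) !mulmxA.
by eexists; split=> [|u /eqE ->]; first by apply/eqE.
Qed.

End Selection.

(** A right inverse of [Q] makes [Q^T] injective, so the form of [K] is evaluated at the nonzero
    vector [Q^T *m x]. *)
Lemma posdef_congr (R : realType) (m n : nat) (K : 'M[R]_n)
    (Q : 'M[R]_(m, n)) (L : 'M[R]_(n, m)) :
  Q *m L = 1%:M -> posdef K -> posdef (Q *m K *m Q^T).
Proof.
move=> QL pK x x0; have Qx0 : Q^T *m x != 0.
  apply: contraNneq x0 => Qx.
  by rewrite -[x]mul1mx -(trmx1 R) -QL trmx_mul -mulmxA Qx mulmx0.
by have := pK _ Qx0; rewrite trmx_mul trmxK !mulmxA.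
Qed.

Lemma posdef_congr_ge0 (R : realType) (m n : nat) (K : 'M[R]_n)
    (Q : 'M[R]_(m, n)) (x : 'cV[R]_m) :
  posdef K -> 0 <= (x^T *m (Q *m K *m Q^T) *m x) 0 0.
Proof.
move=> pK; rewrite !mulmxA -(trmxK Q) -trmx_mul trmxK -mulmxA.
have [->|Qx0] := eqVneq (Q^T *m x) 0; first by rewrite mulmx0 mxE.
exact: ltW (pK _ Qx0).
Qed.

(** By symmetry the inverse is itself a congruence of [K]: $K^{-1} K K^{-T} = K^{-1}$. *)
Lemma posdef_invmx (R : realType) (n : nat) (K : 'M[R]_n) :
  K \in unitmx -> K = K^T -> posdef K -> posdef (invmx K).
Proof.
move=> hK sK pK; have := posdef_congr (mulVmx hK) pK.
by rewrite mulVmx // mul1mx trmx_inv -sK.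
Qed.

Lemma map_Re_mul_real (R : realType) (m n p : nat) (w : 'M[R[i]]_(m, n))
    (S : 'M[R]_(n, p)) :
  map_mx (@complex.Re R) (w *m map_mx (real_complex R) S)
  = map_mx (@complex.Re R) w *m S.
Proof.
apply/matrixP => i j; rewrite !mxE raddf_sum; apply: eq_bigr => k _.
by rewrite !mxE; case: (w i k) => a b /=; ring.
Qed.

Lemma map_Im_mul_real (R : realType) (m n p : nat) (w : 'M[R[i]]_(m, n))
    (S : 'M[R]_(n, p)) :
  map_mx (@complex.Im R) (w *m map_mx (real_complex R) S)
  = map_mx (@complex.Im R) w *m S.
Proof.
apply/matrixP => i j; rewrite !mxE raddf_sum; apply: eq_bigr => k _.
by rewrite !mxE; case: (w i k) => a b /=; ring.
Qed.

(** With $w = a + ib$, everything is expressed by real forms at [a] and [b]. Symmetry makes [z]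
    real, and [z] is then the Rayleigh quotient $(Z(a,a)+Z(b,b))/(X(a,a)+X(b,b))$. *)
Lemma pencil_spec (R : realType) (m : nat) (X Z : 'M[R]_m)
    (w : 'rV[R[i]]_m) (z : R[i]) :
  X^T = X -> Z^T = Z -> posdef X -> posdef (X - Z) ->
  (forall x : 'cV[R]_m, 0 <= (x^T *m Z *m x) 0 0) ->
  w != 0 ->
  w *m map_mx (real_complex R) Z = z *: (w *m map_mx (real_complex R) X) ->
  exists r : R, z = real_complex R r /\ 0 <= r < 1.
Proof.
move=> sX sZ pX pXZ pZ w0 wZ.
set a := map_mx (@complex.Re R) w; set b := map_mx (@complex.Im R) w.
have [r [s zE]] : exists r s, z = Complex r s by case: (z) => r s; exists r, s.
have aZ : a *m Z = r *: (a *m X) - s *: (b *m X).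
  rewrite -!map_Re_mul_real -map_Im_mul_real wZ zE.
  by apply/matrixP => i j; rewrite !mxE; case: (\sum_k _).
have bZ : b *m Z = r *: (b *m X) + s *: (a *m X).
  rewrite -!map_Im_mul_real -map_Re_mul_real wZ zE.
  by apply/matrixP => i j; rewrite !mxE; case: (\sum_k _).
have ab0 : (a != 0) || (b != 0).
  rewrite -negb_and; apply: contraNN w0 => /andP[/eqP a0 /eqP b0].
  apply/eqP/matrixP => i j; move/matrixP/(_ i j): a0; move/matrixP/(_ i j): b0.
  by rewrite !mxE; case: (w i j) => x y /= -> ->.
pose q (S : 'M[R]_m) (u v : 'rV[R]_m) := (u *m S *m v^T) 0 0.
have qC S u v : S^T = S -> q S u v = q S v u.
  by move=> sS; rewrite /q -[u *m S *m v^T]trmxK mxE !trmx_mul trmxK sS mulmxA.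
(* One of [a], [b] may vanish, so only the sum is strictly positive. *)
have qsum S : posdef S -> 0 < q S a a + q S b b.
  move=> pS; have q0 u : u != 0 -> 0 < q S u u.
    by move=> u0; have := pS u^T; rewrite trmxK trmx_eq0; apply.
  have q1 u : 0 <= q S u u.
    have [->|/q0/ltW//] := eqVneq u 0; by rewrite /q !mul0mx mxE.
  case/orP: ab0 => /q0 ?; [exact: ltr_pwDl|exact: ltr_wpDl].
have qZa v : q Z a v = r * q X a v - s * q X b v.
  by rewrite /q aZ mulmxBl -!scalemxAl !mxE.
have qZb v : q Z b v = r * q X b v + s * q X a v.
  by rewrite /q bZ mulmxDl -!scalemxAl !mxE.
have X0 := qsum _ pX; have XZ0 := qsum _ pXZ.
have qB u v : q (X - Z) u v = q X u v - q Z u v.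
  by rewrite /q mulmxBr mulmxBl !mxE.
have Z0 u : 0 <= q Z u u by have := pZ u^T; rewrite trmxK.
have s0 : s = 0.
  (* Computing [q Z a b = q Z b a] from [aZ] and from [bZ], the terms in [r] cancel. *)
  have := qC _ a b sZ; rewrite qZa qZb (qC _ b a sX) => e.
  have /eqP : s * (q X a a + q X b b) = 0 by lra.
  by rewrite mulf_eq0 (gt_eqF X0) orbF => /eqP.
exists r; split; first by rewrite zE s0.
have Zr : q Z a a + q Z b b = r * (q X a a + q X b b).
  by rewrite qZa qZb s0; ring.
(* Both bounds are multiplied by the positive [X]-sum; the upper one then says that the form of
   [X - Z] is positive. *)
rewrite -(pmulr_lge0 _ X0) -Zr addr_ge0 //= -(ltr_pM2r X0) -Zr mul1r.
by move: XZ0; rewrite !qB; lra.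
Qed.

Theorem theorem11 (R : realType) (n : nat) (K : 'M[R]_n) (A B : {set 'I_n})
    (hK : K \in unitmx) (hAB : [disjoint A & B])
    (hX : block (invmx K) A A \in unitmx)
    (hY : block (invmx K) B B \in unitmx) :
  let C := invmx K in
  let X := block C A A in
  let Y := block C B B in
  (forall D : 'M[R]_(#|B|, #|A|),
     is_readout K A B D <-> D = block C B A *m invmx X) /\
  (K = K^T ->
   forall (D1 : 'M[R]_(#|B|, #|A|)) (D2 : 'M[R]_(#|A|, #|B|)),
     is_readout K A B D1 -> is_readout K B A D2 ->
     D1 *m X = (D2 *m Y)^T /\ (D2 *m Y)^T = block C B A /\
     (posdef K ->
      forall z : R[i], z \in spec (D2 *m D1) ->
        exists r : R, z = real_complex R r /\ 0 <= r < 1)).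
Proof.
move=> C X Y; split=> [D|sK D1 D2]; first exact: is_readoutE.
move=> /is_readoutE -/(_ hK hX) D1E /is_readoutE -/(_ hK hY) D2E.
have sC : C^T = C by rewrite /C trmx_inv -sK.
have trb S T : (block C S T)^T = block C T S.
  by rewrite !blockE !trmx_mul trmxK sC mulmxA.
split; first by rewrite D1E D2E !mulmxKV // trb.
split; first by rewrite D2E mulmxKV // trb.
move=> pK z /eigenvalueP[v vM v0].
have pC : posdef C by apply: posdef_invmx.
(* [T] is the block elimination of [B]: [selmx R A - T] will carry [C] by congruence to the Schur
   complement [X - Z]. *)
pose T := block C A B *m invmx Y *m selmx R B.
pose Z := block C A B *m invmx Y *m block C B A.
have trT : T^T = (selmx R B)^T *m invmx Y *m block C B A.
  by rewrite /T !trmx_mul trmx_inv !trb mulmxA.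
have TCA : T *m C *m (selmx R A)^T = Z by rewrite /T /Z (blockE C B A) !mulmxA.
have sZ : Z^T = Z by rewrite /Z !trmx_mul trmx_inv !trb mulmxA.
have ACT : selmx R A *m C *m T^T = Z.
  by rewrite -sZ -TCA (trmx_mul (T *m C)) (trmx_mul T) trmxK sC mulmxA.
(* One factor $Y^{-1}$ cancels against $C[B,B]$. As a congruence of [C], [Z] is positive
   semidefinite. *)
have TCT : T *m C *m T^T = Z.
  have TCB : T *m C *m (selmx R B)^T = block C A B.
    by rewrite /T -2!mulmxA (mulmxA _ C) -blockE mulmxKV.
  by rewrite trT !mulmxA TCB.
have schur : (selmx R A - T) *m C *m (selmx R A - T)^T = X - Z.
  rewrite raddfB /= !mulmxBl !mulmxBr TCA ACT TCT -blockE.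
  by rewrite subrr subr0.
(* Disjointness of [A] and [B] kills the [T] term; the right inverse so obtained makes [X - Z]
   positive definite. *)
have schurL : (selmx R A - T) *m (selmx R A)^T = 1%:M.
  rewrite mulmxBl selmx_mul_tr /T -!mulmxA selmx_mul_tr_disjoint ?mulmx0 ?subr0 //.
  by rewrite disjoint_sym.
apply: (@pencil_spec R _ X Z v) => //.
- by rewrite /X blockE; apply: posdef_congr pC; apply: selmx_mul_tr.
- by rewrite -schur; apply: posdef_congr pC; apply: schurL.
- by move=> x; rewrite -TCT; apply: posdef_congr_ge0.
(* [v] is a left (row) eigenvector, so multiplying its equation on the right by [X] gives the pencil
   equation, as [D2 *m D1 *m X = Z]. *)
rewrite scalemxAl -vM -mulmxA -map_mxM; congr (_ *m map_mx _ _).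
by rewrite D1E D2E !mulmxA mulmxKV.
Qed.
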